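(* Let $0\le a<b<\infty$, let $\mathbb{X}$ be a Polish space, and for each $\epsilon\in[a,b]$ let $\{X^\epsilon(t,\tau,x): t\ge\tau,\ \tau\in\mathbb{R},\ x\in\mathbb{X}\}$ be a family of $\mathbb{X}$-valued stochastic processes with associated transition operators $(P^\epsilon_{\tau,t})_{t\ge\tau}$. Assume that for every compact set $\mathbf{K}\subseteq\mathbb{X}$, every $\tau\in\mathbb{R}$, $t\ge\tau$, $\epsilon_0'\in[a,b]$ and $\delta>0$, $$\lim_{\epsilon\to\epsilon_0'}\ \sup_{x\in\mathbf{K}}\ \mathbb{P}\Big(\big\{\omega\in\Omega:\ \|X^\epsilon(t,\tau,x)-X^{\epsilon_0'}(t,\tau,x)\|_{\mathbb{X}}\ge\delta\big\}\Big)=0 .$$ Let $\epsilon_0\in[a,b]$ and let $\{\eta^{\epsilon_0}_t\}_{t\in\mathbb{R}}$ be a family of probability measures on $\mathbb{X}$. Let $(\epsilon_n)_{n\in\mathbb{N}}\subseteq[a,b]$ and, for each $n\in\mathbb{N}$, let $\{\eta^{\epsilon_n}_t\}_{t\in\mathbb{R}}$ be an evolution system of probability measures of $(P^{\epsilon_n}_{\tau,t})_{t\ge\tau}$ on $\mathbb{X}$. If $(P^{\epsilon_0}_{\tau,t})_{t\ge\tau}$ is Feller, $\epsilon_n\to\epsilon_0$, and $\eta^{\epsilon_n}_t\to\eta^{\epsilon_0}_t$ weakly for each $t\in\mathbb{R}$, then $\{\eta^{\epsilon_0}_t\}_{t\in\mathbb{R}}$ is an evolution system of probability measures of $(P^{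\epsilon_0}_{\tau,t})_{t\ge\tau}$.
   Context: $\mathbb{X}$ is a Polish space, i.e. a complete separable metric space; the distance between $x,y\in\mathbb{X}$ is written $\|x-y\|_{\mathbb{X}}$. $\mathscr{B}(\mathbb{X})$ is its Borel $\sigma$-algebra, $\mathcal{P}(\mathbb{X})$ the set of Borel probability measures on $\mathbb{X}$, and $B_b(\mathbb{X})$ (resp. $C_b(\mathbb{X})$) the space of bounded Borel (resp. bounded continuous) real functions on $\mathbb{X}$. $(\Omega,\mathcal{F},\mathbb{P})$ is a probability space. For each $\epsilon\in[a,b]$, $\tau\in\mathbb{R}$ and $x\in\mathbb{X}$, $\{X^\epsilon(t,\tau,x)\}_{t\ge\tau}$ is an $\mathbb{X}$-valued stochastic process on $\Omega$ with $X^\epsilon(\tau,\tau,x)=x$; the parameter $\epsilon$ is the noise intensity. Transition operator: $(P^\epsilon_{\tau,t}\varphi)(x)=\mathbb{E}[\varphi(X^\epsilon(t,\tau,x))]$ for $\varphi\in B_b(\mathbb{X})$, $t\ge\tau$. Transition probability function: $P^\epsilon_{\tau,t}(x,\Lambda)=\mathbb{P}\{\omega\in\Omega: X^\epsilon(t,\tau,x)\in\Lambda\}$ for $\Lambda\in\mathscr{B}(\mathbb{X})$, which is assumed to be Borel measurable in $x$. Adjoint operator: $Q^\epsilon_{\tau,t}\eta(\Lambda)=\int_{\mathbb{X}}P^\epsilon_{\tau,t}(x,\Lambda)\,\eta(dx)$ for $\eta\in\mathcal{P}(\mathbb{X})$. A family $\{\eta_t\}_{t\in\mathbb{R}}\subseteq\mathcal{P}(\mathbb{X})$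 is an evolution system of probability measures of $(P^\epsilon_{\tau,t})_{t\ge\tau}$ if $Q^\epsilon_{\tau,t}\eta_\tau=\eta_t$ for all $t\ge\tau$, $\tau\in\mathbb{R}$. $(P^\epsilon_{\tau,t})_{t\ge\tau}$ is Feller if $P^\epsilon_{\tau,t}\varphi\in C_b(\mathbb{X})$ for every $\varphi\in C_b(\mathbb{X})$ and all $t\ge\tau$. *)

(* Defs.v *)
From HB Require Import structures.
From mathcomp Require Import all_boot all_order all_algebra.
From mathcomp Require Import all_classical all_reals all_analysis.
From mathcomp Require Import measurable_realfun.

Set Implicit Arguments.
Unset Strict Implicit.
Unset Printing Implicit Defensive.

Import Order.TTheory GRing.Theory Num.Theory.
Import numFieldNormedType.Exports.

Local Open Scope classical_set_scope.
Local Open Scope ring_scope.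

(* The library's complete spaces and measurable types are pointed, so these
   spaces are nonempty, as is any space carrying a probability measure. *)
#[short(type="completeMetricType")]
HB.structure Definition CompleteMetric (K : numDomainType) :=
  {T of Metric K T & Complete T}.

Definition separable_space (T : topologicalType) : Prop :=
  exists2 S : set T, countable S & dense S.

Notation borel T := (g_sigma_algebraType (@open T)).

Definition Cb (R : realType) (T : topologicalType) : set (T -> R) :=
  [set f | continuous f /\ bounded_fun f].

Definition weak_cvg (R : realType) (T : ptopologicalType)
    (mu_ : nat -> probability (borel T) R) (mu : probability (borel T) R) :
    Prop :=
  forall f : T -> R, Cb f ->
    (\int[mu_ n]_x f x)%R @[n --> \oo] --> (\int[mu]_x f x)%R.

(* A family of processes is a function  t tau x w |-> X(t, tau, x)(w).  It is
   total in (t, tau), but only its values at t >= tau are meaningful, and only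
   these are used below. *)
Section transition.
Context {R : realType} {T : ptopologicalType}.
Context {d : measure_display} {Omega : measurableType d}.
Variables (P : probability Omega R) (X : R -> R -> T -> Omega -> T).

Definition trans_op (tau t : R) (phi : T -> R) : T -> R :=
  fun x => fine ('E_P[phi \o X t tau x])%E.

Definition trans_prob (tau t : R) (x : T) (L : set T) : \bar R :=
  P [set w | L (X t tau x w)].

Definition adjoint_op (tau t : R) (eta : probability (borel T) R)
    (L : set T) : \bar R :=
  (\int[eta]_x trans_prob tau t x L)%E.

(* Equality of measures is equality on Borel sets: the library's measures are
   functions on all subsets, with arbitrary values at nonmeasurable ones. *)
Definition evolution_system (eta : R -> probability (borel T) R) : Prop :=
  forall tau t : R, tau <= t ->
    forall L : set (borel T), measurable L ->
      adjoint_op tau t (eta tau) L = eta t L.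

Definition feller : Prop :=
  forall tau t : R, tau <= t ->
    forall phi : T -> R, Cb phi -> Cb (trans_op tau t phi).

Definition stochastic_family : Prop :=
  (forall tau t x, tau <= t ->
     measurable_fun [set: Omega] (X t tau x : Omega -> borel T)) /\
  (forall tau x w, X tau tau x w = x) /\
  (forall tau t, tau <= t -> forall L : set (borel T), measurable L ->
     measurable_fun [set: borel T] (fun x : borel T => trans_prob tau t x L)).

End transition.

(* Main.v *)
(** Borel probabilities on a metric space are determined by the integrals of
    Lipschitz functions [f] with values in [[0, 1]], so it is enough to compare
    [P^{eps0} f] integrated against [eta0_tau] with [f] integrated against
    [eta0_t].  Both are limits: of the integrals of [P^{eps0} f] against
    [eta_n_tau] by the Feller property, and of those of [P^{eps_n} f] against
    [eta_n_tau] by invariance.  These sequences have the same limit: a weakly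
    convergent sequence on a Polish space is tight, and on a compact set
    [|P^{eps_n} f - P^{eps0} f| <= k delta + sup P(dist >= delta)] for a
    [k]-Lipschitz [f]. *)
Require Import Defs.
From HB Require Import structures.
From mathcomp Require Import all_boot all_order all_algebra.
From mathcomp Require Import all_classical all_reals all_analysis.
From mathcomp Require Import measurable_realfun.
From mathcomp Require Import lra.

Set Implicit Arguments.
Unset Strict Implicit.
Unset Printing Implicit Defensive.

Import Order.TTheory GRing.Theory Num.Theory.
Import numFieldNormedType.Exports.

Local Open Scope classical_set_scope.
Local Open Scope ring_scope.

(** * Lipschitz functions and distance to a set *)

Section metric_functions.
Context {R : realType} {T : metricType R}.
Implicit Types (A U : set T) (f : T -> R) (x y : T).

Definition mlipschitz (k : R) f := forall x y, `|f x - f y| <= k * mdist x y.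

Lemma mlipschitz_continuous k f : mlipschitz k f -> continuous f.
Proof.
move=> fk x; apply/cvgrPdist_lt => e e0.
have k0 : 0 < `|k| + 1 by rewrite ltr_wpDl.
have d0 : 0 < e / (`|k| + 1) by rewrite divr_gt0.
apply/nbhs_ballP; exists (e / (`|k| + 1)) => //= y.
rewrite ballEmdist /= => xy; apply: le_lt_trans (fk x y) _.
rewrite ltr_pdivlMr// mulrC in xy; apply: le_lt_trans xy.
rewrite ler_wpM2r ?mdist_ge0// (le_trans (ler_norm k))//; lra.
Qed.

Lemma open_mball x (r : R) : open (ball x r).
Proof.
rewrite openE => y; rewrite ballEmdist /= => xy; apply/nbhs_ballP.
exists (r - mdist x y) => /=; first by rewrite subr_gt0.
move=> z; rewrite !ballEmdist /= => yz.
by apply: le_lt_trans (metric_triangle x y z) _; lra.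
Qed.

(** For empty [A] the infimum takes its default value 0, so that positivity off a closed set holds
    only for nonempty [A]. *)
Definition mdist_set A x : R := inf [set mdist x y | y in A].

Lemma mdist_set_ge0 A x : 0 <= mdist_set A x.
Proof.
have [->|A0] := eqVneq A set0; first by rewrite /mdist_set image_set0 inf0.
apply: lb_le_inf; first by case/set0P: A0 => y Ay; exists (mdist x y), y.
by move=> _ [y _ <-]; exact: mdist_ge0.
Qed.

Lemma mdist_set_le A x y : A y -> mdist_set A x <= mdist x y.
Proof.
move=> Ay; apply: ge_inf; last by exists y.
by exists 0 => _ [z _ <-]; exact: mdist_ge0.
Qed.

Lemma mdist_set_triangle A x y : mdist_set A x <= mdist x y + mdist_set A y.
Proof.
have [->|A0] := eqVneq A set0.
  by rewrite /mdist_set !image_set0 inf0 addr0 mdist_ge0.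
rewrite -lerBlDl; apply: lb_le_inf.
  by case/set0P: A0 => z Az; exists (mdist y z), z.
move=> _ [z Az <-]; rewrite lerBlDl.
exact: le_trans (mdist_set_le x Az) (metric_triangle x y z).
Qed.

Lemma mdist_set_gt0 A x : closed A -> A !=set0 -> ~ A x -> 0 < mdist_set A x.
Proof.
move=> cA [a Aa] nAx.
have /nbhs_ballP[r /= r0 rA] : nbhs x (~` A).
  by apply: open_nbhs_nbhs; split => //; exact: closed_openC.
apply: (lt_le_trans r0); apply: lb_le_inf; first by exists (mdist x a), a.
move=> _ [y Ay <-]; rewrite leNgt; apply/negP => xy.
by apply: (rA y) => //; rewrite ballEmdist.
Qed.

(** The functions [min 1 (n * D x)], with [D] the distance to the complement of [U], are
    [n]-Lipschitz, vanish off [U], and equal 1 at a point of [U] as soon as [n] exceeds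
    [1 / D x]. *)
Lemma open_indic_mlipschitz_cvg U : open U ->
  exists f_ : nat -> T -> R,
  [/\ forall n x, 0 <= f_ n x <= \1_U x,
      forall n, exists k, mlipschitz k (f_ n) &
      forall x, f_ n x @[n --> \oo] --> (\1_U x : R)].
Proof.
(* The whole space is treated apart: its complement is empty, and the default distance 0 would give
   zero functions. *)
move=> oU; have [->|UT] := eqVneq U setT.
  exists (fun _ _ => 1); split.
  - by move=> _ x; rewrite indicT ler01 lexx.
  - by move=> _; exists 0 => x y; rewrite subrr normr0 mul0r.
  - by move=> x; rewrite indicT; exact: cvg_cst.
have UC0 : ~` U !=set0.
  by apply/set0P; apply: contra_neq UT => UC; rewrite -(setCK U) UC setC0.
have cUC : closed (~` U) by exact: open_closedC.
pose D := mdist_set (~` U).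
have D0 x : ~ U x -> D x = 0.
  move=> Ux; apply/eqP; rewrite eq_le mdist_set_ge0 andbT.
  by rewrite -(mdistxx x); exact: mdist_set_le.
exists (fun n x => Num.min 1 (n%:R * D x)); split.
- move=> n x; rewrite le_min ler01 mulr_ge0 ?mdist_set_ge0//=.
  rewrite indicE; have [/set_mem Ux|/negP Ux] := boolP (x \in U).
    by rewrite ge_min lexx.
  by rewrite D0 ?mulr0 ?ge_min ?lexx ?orbT// => Ux'; apply: Ux; exact/mem_set.
- move=> n; exists n%:R => x y.
  have n0 : 0 <= n%:R :> R by [].
  have H z w : D z - D w <= mdist z w.
    by rewrite lerBlDr; exact: mdist_set_triangle.
  have := ler_wpM2l n0 (H x y).
  have := ler_wpM2l n0 (H y x); rewrite (metric_sym y x) !mulrBr.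
  have : 0 <= n%:R * mdist x y by rewrite mulr_ge0 ?mdist_ge0.
  (* With the products generalized, each case of the two minima is linear. *)
  move: (n%:R * D x) (n%:R * D y) (n%:R * mdist x y) => p q r.
  rewrite ler_norml; case: (leP 1 p); case: (leP 1 q); lra.
- move=> x; rewrite indicE; have [/set_mem Ux|/negP Ux] := boolP (x \in U).
    have Dx : 0 < D x by apply: mdist_set_gt0 => //; apply.
    apply: cvg_near_cst.
    exists (Num.truncn (D x)^-1).+1 => // n /= nD.
    rewrite /= min_l// -ler_pdivrMr// div1r.
    apply: ltW; apply: lt_le_trans (truncnS_gt _) _.
    by rewrite ler_nat.
  rewrite (_ : (fun n => _) = cst 0); first exact: cvg_cst.
  apply/funext => n; rewrite D0 ?mulr0 ?min_r//.
  by move=> Ux'; apply: Ux; exact/mem_set.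
Qed.

End metric_functions.

(** * Compactness and separability in complete metric spaces *)

Section complete_metric.
Context {R : realType} {T : completeMetricType R}.

(** An ultrafilter containing [K] contains one ball of each finite cover, so it is Cauchy;
    completeness gives a limit, and closedness puts it in [K]. *)
Lemma closed_totally_bounded_compact (K : set T) : closed K ->
  (forall r : R, 0 < r -> exists s : nat -> T, exists j,
     K `<=` \bigcup_(i < j) ball (s i) r) ->
  compact K.
Proof.
move=> cK tK; rewrite compact_ultra => F UF FK.
have PF : ProperFilter F by exact: ultra_proper.
have : cauchy F.
  apply: cauchy_exP => r r0; have [s [j Kj]] := tK r r0.
  have : F (\bigcup_(i < j) ball (s i) r) by exact: filterS FK.
  (* Induction on the number of balls: if the last one is not in [F], its complement is, and the
     remaining union still belongs to [F]. *)
  elim: j {Kj} => [|j IH].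
    rewrite bigcup_mkord big_ord0 => F0.
    by have := filter_not_empty _ F0.
  have [Fb|Fb] := in_ultra_setVsetC (ball (s j) r) UF; first by exists (s j).
  move=> Fj; apply: IH; apply: filterS (filterI Fj Fb) => x [[i /= ij xi] nxj].
  exists i => //=; move: ij; rewrite ltnS leq_eqVlt => /predU1P[ij|//].
  by rewrite ij in xi.
move=> /cauchy_cvg Fc; exists (lim F); split => //.
by apply: (closed_cvg _ cK) Fc; exact: FK.
Qed.

Lemma separable_dense_seq : separable_space T ->
  exists s : nat -> T, forall x (r : R), 0 < r -> exists i, mdist (s i) x < r.
Proof.
move=> [S /pcard_surjP[f fS] dS]; exists f => x r r0.
have [y [xy /fS[i _ fi]]] :=
  dS (ball x r) (ex_intro _ x (ballxx x r0)) (open_mball x r).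
by exists i; rewrite fi metric_sym; rewrite ballEmdist in xy.
Qed.

End complete_metric.

(** * Integrals of functions with values in the unit interval *)

Section probability_integral.
Context {R : realType} {d : measure_display} {T : measurableType d}.
Variable mu : probability T R.

Lemma probability_integrable01 (f : T -> R) : measurable_fun [set: T] f ->
  (forall x, 0 <= f x <= 1) -> mu.-integrable [set: T] (EFin \o f).
Proof.
move=> mf f01; apply: measurable_bounded_integrable => //.
  by rewrite (le_lt_trans (probability_le1 _ _))// ltry.
exists 1; split => // r r1 x _ /=; have /andP[f0 f1] := f01 x.
by rewrite ger0_norm// (le_trans f1)// ltW.
Qed.

Lemma Rintegral_indic (A : set T) : measurable A ->
  (\int[mu]_x (\1_A x : R))%R = fine (mu A).
Proof. by move=> mA; rewrite /Rintegral integral_indic// setIT. Qed.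

Lemma Rintegral_cvg_indic (f_ : nat -> T -> R) (A : set T) : measurable A ->
  (forall n, measurable_fun [set: T] (f_ n)) ->
  (forall n x, 0 <= f_ n x <= \1_A x) ->
  (forall x, f_ n x @[n --> \oo] --> (\1_A x : R)) ->
  (\int[mu]_x f_ n x)%R @[n --> \oo] --> fine (mu A).
Proof.
move=> mA mf f01 fA.
have fle1 n x : 0 <= f_ n x <= 1.
  by have /andP[-> /le_trans ->//] := f01 n x.
rewrite -Rintegral_indic//; apply: fine_cvg.
rewrite fineK; last first.
  apply: integrable_fin_num => //; apply: probability_integrable01 => //.
  by move=> x; rewrite indicE; case: (_ \in _); rewrite ?lexx ?ler01.
apply: (@dominated_cvg _ _ _ mu _ measurableT _ _ (cst 1%E)) => //.
- by move=> n; exact/measurable_EFinP.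
- move=> x _; apply: cvg_EFin; first exact: nearW.
  exact: fA.
- exact: finite_measure_integrable_cst.
- move=> n x _ /=; rewrite lee_fin; have /andP[f0 f1] := fle1 n x.
  by rewrite ger0_norm.
Qed.

Lemma Rintegral_dist_le (f g : T -> R) (A : set T) (c : R) :
  measurable A -> 0 <= c ->
  measurable_fun [set: T] f -> (forall x, 0 <= f x <= 1) ->
  measurable_fun [set: T] g -> (forall x, 0 <= g x <= 1) ->
  (forall x, A x -> `|f x - g x| <= c) ->
  `|(\int[mu]_x f x)%R - (\int[mu]_x g x)%R| <= c + fine (mu (~` A)).
Proof.
move=> mA c0 mf f01 mg g01 fgc.
have mAC : measurable (~` A) by exact: measurableC.
have jf := probability_integrable01 mf f01.
have jg := probability_integrable01 mg g01.
have jA : mu.-integrable setT (EFin \o (\1_(~` A) : T -> R)).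
  apply: probability_integrable01 => // w.
  by rewrite indicE; case: (_ \in _); rewrite ?lexx ?ler01.
have jc : mu.-integrable setT (EFin \o (cst c : T -> R)).
  exact: finite_measure_integrable_cst.
rewrite -RintegralB//.
apply: (le_trans (le_normr_Rintegral _ _)) => //.
  by have := integrableB measurableT jf jg; exact: eq_integrable.
rewrite -(Rintegral_indic mAC).
have -> : c = (\int[mu]__ c)%R.
  by rewrite Rintegral_cst// [X in fine X](@probability_setT _ _ _ mu) mulr1.
rewrite -RintegralD//; apply: le_Rintegral => //.
- have := integrableB measurableT jf jg => /integrable_abse.
  by apply: eq_integrable.
- by have := integrableD measurableT jc jA; exact: eq_integrable.
- move=> x _; rewrite indicE.
  have [xA|/negP xA] := boolP (x \in ~` A); rewrite /= ?mulr1n ?mulr0n.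
    have /andP[a0 a1] := f01 x; have /andP[b0 b1] := g01 x.
    by rewrite ler_norml; lra.
  rewrite addr0; apply: fgc; apply: contrapT => nAx; apply: xA.
  exact/mem_set.
Qed.

End probability_integral.
Arguments Rintegral_cvg_indic {R d T} mu f_ A.

(** * Borel sets and continuous functions *)

Section borel_space.
Context {R : realType} {T : ptopologicalType}.

Lemma open_borel_measurable (U : set T) :
  open U -> measurable (U : set (borel T)).
Proof. exact: sub_sigma_algebra. Qed.

Lemma closed_borel_measurable (C : set T) :
  closed C -> measurable (C : set (borel T)).
Proof.
move=> cC; rewrite -(setCK C); apply: measurableC.
by apply: open_borel_measurable; exact: closed_openC.
Qed.

Lemma continuous_borel_measurable (f : T -> R) :
  continuous f -> measurable_fun [set: borel T] (f : borel T -> R).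
Proof.
move=> /continuousP cf; apply: (measurability _ (RGenOpens.measurableE R)).
move=> _ [_ [a [b ->] <-]]; rewrite setTI; apply: open_borel_measurable.
exact/cf/interval_open.
Qed.

Lemma Cb01 (f : T -> R) : continuous f -> (forall x, 0 <= f x <= 1) -> Cb f.
Proof.
move=> cf f01; split=> //; exists 1; split => // r r1 x _ /=.
by have /andP[f0 f1] := f01 x; rewrite ger0_norm// (le_trans f1)// ltW.
Qed.

End borel_space.

(** * Uniqueness, weak convergence and tightness of Borel probabilities *)

Section borel_probability.
Context {R : realType} {T : completeMetricType R}.
Implicit Types mu nu : probability (borel T) R.

(** Approximating indicators from below gives equality on open sets, which are stable under
    intersection and generate the Borel sets. *)
Lemma eq_probability_mlipschitz mu nu :
  (forall k (f : T -> R), mlipschitz k f -> (forall x, 0 <= f x <= 1) ->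
    (\int[mu]_x f x)%R = (\int[nu]_x f x)%R) ->
  forall L : set (borel T), measurable L -> mu L = nu L.
Proof.
move=> munu; apply: (@measure_unique _ R (borel T) open (fun=> setT)) => //.
- by move=> A B; exact: openI.
- by move=> _; exact: openT.
- by rewrite bigcup_const.
- move=> U oU; have mU := open_borel_measurable oU.
  have [f_ [f01 fk fU]] := open_indic_mlipschitz_cvg oU.
  have mf n : measurable_fun setT (f_ n : borel T -> R).
    apply: continuous_borel_measurable.
    by have [k /mlipschitz_continuous] := fk n.
  rewrite -[LHS]fineK ?fin_num_measure// -[RHS]fineK ?fin_num_measure//.
  congr EFin; have := Rintegral_cvg_indic mu _ _ mU mf f01 fU.
  rewrite (_ : (fun n => _) = (fun n => \int[nu]_x f_ n x)%R); last first.
    apply/funext => n; have [k fnk] := fk n; apply: (munu k) => // x.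
    by have /andP[-> /le_trans ->//] := f01 n x.
  move=> cmu; have cnu := Rintegral_cvg_indic nu _ _ mU mf f01 fU.
  exact: cvg_unique cmu cnu.
- by move=> _; rewrite (le_lt_trans (probability_le1 _ _))// ltry.
Qed.

(** The open-set half of the portmanteau theorem: one fixed approximant [f_ m] below the indicator
    already has [mu]-integral above [c], and it is a test function for weak convergence. *)
Lemma weak_cvg_open_gt (mu_ : nat -> probability (borel T) R) mu (U : set T)
    (c : R) : weak_cvg mu_ mu -> open U -> c < fine (mu U) ->
  \forall n \near \oo, c < fine (mu_ n U).
Proof.
move=> wmu oU cU; have mU := open_borel_measurable oU.
have [f_ [f01 fk fU]] := open_indic_mlipschitz_cvg oU.
have f01' n x : 0 <= f_ n x <= 1.
  by have /andP[-> /le_trans ->//] := f01 n x.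
have cf n : continuous (f_ n) by have [k /mlipschitz_continuous] := fk n.
have mf n : measurable_fun setT (f_ n : borel T -> R).
  exact: continuous_borel_measurable.
have [m _ /(_ m (leqnn m)) cm] :=
  cvgr_gt _ (Rintegral_cvg_indic mu _ _ mU mf f01 fU) c cU.
have Cbf : Cb (f_ m) := Cb01 (cf m) (f01' m).
apply: filterS (cvgr_gt _ (wmu _ Cbf) c cm) => n cn; apply: (lt_le_trans cn).
rewrite -Rintegral_indic//; apply: le_Rintegral => //.
- exact: probability_integrable01.
- apply: probability_integrable01 => // x.
  by rewrite indicE; case: (_ \in _); rewrite ?lexx ?ler01.
- by move=> x _; have /andP[] := f01 m x.
Qed.

Lemma probability_ball_cover_gt mu (s : nat -> T) (r c : R) :
  (forall x, exists i, mdist (s i) x < r) -> c < 1 ->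
  exists j, c < fine (mu (\bigcup_(i < j) ball (s i) r)).
Proof.
move=> sr c1; pose F j : set (borel T) := \bigcup_(i < j) ball (s i) r.
have mF j : measurable (F j).
  by apply: open_borel_measurable; apply: bigcup_open => i _; exact: open_mball.
have UF : \bigcup_j F j = setT.
  apply/seteqP; split => // x _; have [i xi] := sr x.
  by exists i.+1 => //; exists i => //=; rewrite ballEmdist.
have : mu (F n) @[n --> \oo] --> 1%:E.
  rewrite -(@probability_setT _ _ _ mu) -UF; apply: nondecreasing_cvg_mu => //.
    by rewrite UF; exact: measurableT.
  move=> j k jk; apply/subsetPset => x [i /= ij xi].
  by exists i => //=; exact: leq_trans ij jk.
move=> /fine_cvgP[_].
by move=> /cvgr_gt /(_ c c1)[j _ /(_ j (leqnn j))]; exists j.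
Qed.

(* Only finitely many terms escape the bound given by weak convergence, and
   each of them is handled separately. *)
Lemma weak_cvg_ball_cover (mu_ : nat -> probability (borel T) R) mu
    (s : nat -> T) (r c : R) :
  weak_cvg mu_ mu -> (forall x, exists i, mdist (s i) x < r) -> c < 1 ->
  exists j, forall n, c < fine (mu_ n (\bigcup_(i < j) ball (s i) r)).
Proof.
move=> wmu sr c1; pose F j : set (borel T) := \bigcup_(i < j) ball (s i) r.
have oF j : open (F j).
  by apply: bigcup_open => i _; exact: open_mball.
have mF j : measurable (F j) by exact: open_borel_measurable.
have leF nu j k : (j <= k)%N -> fine (nu (F j)) <= fine (nu (F k)).
  move=> jk; rewrite fine_le ?fin_num_measure// le_measure ?inE//.
  by move=> x [i /= ij xi]; exists i => //=; exact: leq_trans ij jk.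
have [j0 cj0] := probability_ball_cover_gt mu sr c1.
have [N _ HN] := weak_cvg_open_gt wmu (oF j0) cj0.
suff [j1 Hj1] : exists j, forall n, (n < N)%N -> c < fine (mu_ n (F j)).
  exists (maxn j0 j1) => n; have [/HN cn|/Hj1 cn] := leqP N n.
    by apply: (lt_le_trans cn); apply: leF; exact: leq_maxl.
  by apply: (lt_le_trans cn); apply: leF; exact: leq_maxr.
elim: N {HN} => [|N [j IH]]; first by exists 0%N.
have [k ck] := probability_ball_cover_gt (mu_ N) sr c1.
exists (maxn j k) => n; rewrite ltnS leq_eqVlt => /predU1P[->|/IH cn].
  by apply: (lt_le_trans ck); apply: leF; exact: leq_maxr.
by apply: (lt_le_trans cn); apply: leF; exact: leq_maxl.
Qed.

(** At each scale [r k], finitely many balls carry almost all the mass of every [mu_ n]. The closure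
    of the intersection of these unions over [k] is totally bounded. *)
Lemma weak_cvg_tight (mu_ : nat -> probability (borel T) R) mu (e : R) :
  separable_space T -> weak_cvg mu_ mu -> 0 < e ->
  exists2 K : set T, compact K & forall n, fine (mu_ n (~` K)) <= e.
Proof.
move=> /separable_dense_seq[s sP] wmu e0.
pose r k : R := k.+1%:R^-1.
have r0 k : 0 < r k by rewrite invr_gt0.
(* The mass lost at scale [k] is below [e / 2 ^ k.+1]; these bounds sum to [e]. *)
have ek k : 1 - e / (2 ^ k.+1)%:R < 1.
  by rewrite ltrBlDr ltrDl divr_gt0// ltr0n expn_gt0.
have H k := weak_cvg_ball_cover wmu (fun x => sP x _ (r0 k)) (ek k).
have {H}[j jP] := choice H.
pose G k : set (borel T) := \bigcup_(i < j k) ball (s i) (r k).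
have mG k : measurable (G k).
  by apply: open_borel_measurable; apply: bigcup_open => i _; exact: open_mball.
pose K : set T := closure (\bigcap_k G k).
have cK : closed K by exact: closed_closure.
exists K.
  apply: closed_totally_bounded_compact => // q q0.
  (* A point of the closure is within [r k] of a point of [G k], itself within [r k] of a center;
     this [k] makes [2 * r k <= q]. *)
  pose k := Num.truncn (2 / q).
  have kq : r k + r k <= q.
    rewrite -mulr2n -mulr_natl ler_pdivrMr// mulrC -ler_pdivrMr//.
    by apply: ltW; exact: truncnS_gt.
  exists s, (j k) => x /(_ _ (nbhsx_ballx x _ (r0 k)))[y [/(_ k I)[i /= ij iy]]].
  move=> xy; exists i => //=; apply: (le_ball kq).
  by apply: ball_triangle iy _; exact: ball_sym.
move=> n; rewrite -lee_fin fineK ?fin_num_measure//; last first.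
  by apply: measurableC; exact: closed_borel_measurable.
apply: (@le_trans _ _ (mu_ n (\bigcup_k ~` G k))).
  apply: le_measure; rewrite ?inE.
  - by apply: measurableC; exact: closed_borel_measurable.
  - by apply: bigcup_measurable => k _; exact: measurableC.
  - by rewrite -setC_bigcap; apply: subsetC; exact: subset_closure.
apply: (@le_trans _ _ (\sum_(k <oo) mu_ n (~` G k))%E).
  apply: measure_sigma_subadditive => //.
  - by move=> k; exact: measurableC.
  - by apply: bigcup_measurable => k _; exact: measurableC.
apply: le_trans (epsilon_trick0 xpredT (ltW e0)).
apply: lee_nneseries => // k _.
rewrite probability_setC// -[X in (_ - X)%E]fineK ?fin_num_measure//.
by rewrite -EFinB lee_fin lerBlDr -lerBlDl; exact/ltW/jP.
Qed.

End borel_probability.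

(** * The law of a process started from a random point *)

Section law_kernel.
Context {R : realType} {T : ptopologicalType}.
Context {d : measure_display} {Omega : measurableType d}.
Variables (P : probability Omega R) (Y : T -> Omega -> T).
Hypothesis mY : forall x, measurable_fun [set: Omega] (Y x : Omega -> borel T).
Hypothesis mPY : forall L : set (borel T), measurable L ->
  measurable_fun [set: borel T] (fun x : borel T => P [set w | L (Y x w)]).

Definition law (x : borel T) : probability (borel T) R :=
  distribution P (mfun_Sub (mem_set (mY x))).

Let integral_law x (f : borel T -> \bar R) :
  measurable_fun [set: borel T] f -> (forall y, 0 <= f y)%E ->
  (\int[law x]_y f y = \int[P]_w f (Y x w))%E.
Proof. by move=> mf f0; rewrite ge0_integral_distribution. Qed.

(** By [mPY] the laws form a kernel, and integrating a nonnegative function against a kernel is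
    measurable in the parameter. *)
Lemma measurable_integral_law (f : borel T -> \bar R) :
  measurable_fun [set: borel T] f -> (forall y, 0 <= f y)%E ->
  measurable_fun [set: borel T] (fun x : borel T => \int[P]_w f (Y x w))%E.
Proof.
move=> mf f0; under eq_fun do rewrite -integral_law//.
exact: measurable_fun_integral_kernel.
Qed.

(* The composition of kernels is parameterized, whence the dummy factor. *)
Let law_snd (p : unit * borel T) : {measure set (borel T) -> \bar R} :=
  law p.2.

Let measurable_law_snd L : measurable L ->
  measurable_fun [set: unit * borel T] (law_snd ^~ L).
Proof. by move=> mL; exact: measurableT_comp (mPY mL) measurable_snd. Qed.

HB.instance Definition _ := isKernel.Build _ _ _ _ _ law_snd measurable_law_snd.

Let law_snd_setT p : law_snd p setT = 1%E.
Proof. exact: probability_setT. Qed.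

HB.instance Definition _ :=
  Kernel_isProbability.Build _ _ _ _ _ law_snd law_snd_setT.

Variable eta : probability (borel T) R.

(** The initial law as a kernel from a one-point space: composing it with [law_snd] yields a measure
    together with its iterated integral formula. *)
Let init (_ : unit) : {measure set (borel T) -> \bar R} := eta.

Let measurable_init L : measurable L -> measurable_fun [set: unit] (init ^~ L).
Proof. by move=> _; exact: measurable_cst. Qed.

HB.instance Definition _ := isKernel.Build _ _ _ _ _ init measurable_init.

Let init_setT p : init p setT = 1%E.
Proof. exact: probability_setT. Qed.

HB.instance Definition _ := Kernel_isProbability.Build _ _ _ _ _ init init_setT.

Let mix : set (borel T) -> \bar R := kcomp init law_snd tt.

HB.instance Definition _ := Measure.on mix.

Let mixE L : mix L = (\int[eta]_x P [set w | L (Y x w)])%E.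
Proof. by []. Qed.

Let mix_setT : mix setT = 1%E.
Proof.
rewrite mixE; under eq_integral do rewrite [X in P X](_ : _ = setT)//.
rewrite probability_setT integral_cst//.
by rewrite [X in (_ * X)%E](@probability_setT _ _ _ eta) mule1.
Qed.

HB.instance Definition _ :=
  Measure_isProbability.Build _ _ _ mix mix_setT.

Definition mixture : probability (borel T) R := mix.

Lemma mixtureE L : mixture L = (\int[eta]_x P [set w | L (Y x w)])%E.
Proof. exact: mixE. Qed.

Lemma integral_mixture (f : borel T -> \bar R) :
  measurable_fun [set: borel T] f -> (forall y, 0 <= f y)%E ->
  (\int[mixture]_y f y = \int[eta]_x \int[P]_w f (Y x w))%E.
Proof.
move=> mf f0; rewrite /mixture /mix integral_kcomp//.
by apply: eq_integral => x _; rewrite /law_snd /= integral_law.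
Qed.

End law_kernel.

(** * Adjoint and transition operators of one stochastic family *)

Section stochastic_family.
Context {R : realType} {T : ptopologicalType}.
Context {d : measure_display} {Omega : measurableType d}.
Variables (P : probability Omega R) (X : R -> R -> T -> Omega -> T).
Hypothesis hX : stochastic_family P X.
Variables (tau t : R).
Hypothesis taut : tau <= t.

Lemma stochastic_family_measurable x :
  measurable_fun [set: Omega] (X t tau x : Omega -> borel T).
Proof. by have [mX _] := hX; exact: mX. Qed.

Let mX := stochastic_family_measurable.

Let mPX (L : set (borel T)) : measurable L ->
  measurable_fun [set: borel T] (fun x : borel T => P [set w | L (X t tau x w)]).
Proof. by have [_ [_]] := hX; exact. Qed.

(** [adjoint_op] is a bare set function; the mixture of laws realizes it as a probability and gives
    its integrals. *)
Lemma adjoint_op_probability (eta : probability (borel T) R) :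
  exists nu : probability (borel T) R,
    (forall L, adjoint_op P X tau t eta L = nu L) /\
    forall f : borel T -> \bar R, measurable_fun [set: borel T] f ->
      (forall y, 0 <= f y)%E ->
      (\int[nu]_y f y = \int[eta]_x \int[P]_w f (X t tau x w))%E.
Proof.
by exists (mixture mX mPX eta); split => [L|f]; [rewrite mixtureE|exact: integral_mixture].
Qed.

Variable f : borel T -> R.
Hypotheses (mf : measurable_fun [set: borel T] f) (f01 : forall x, 0 <= f x <= 1).

Lemma trans_op_integrable x :
  P.-integrable [set: Omega] (EFin \o (f \o X t tau x)).
Proof.
apply: probability_integrable01 => [|w]; last exact: f01.
exact: measurableT_comp mf (mX x).
Qed.

Lemma EFin_trans_op x :
  ((trans_op P X tau t f x)%:E = \int[P]_w (f (X t tau x w))%:E)%E.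
Proof.
rewrite /trans_op unlock fineK//.
by apply: integrable_fin_num => //; exact: trans_op_integrable.
Qed.

(** In the theorem only the family at [eps0] is Feller; for the others, measurability comes from
    that of the transition probabilities. *)
Lemma measurable_trans_op :
  measurable_fun [set: borel T] (trans_op P X tau t f : borel T -> R).
Proof.
apply/measurable_EFinP; rewrite (_ : _ \o _ = fun x => \int[P]_w (f (X t tau x w))%:E)%E;
  last by apply/funext => x; exact: EFin_trans_op.
apply: (measurable_integral_law mX mPX (f := EFin \o f)).
  exact/measurable_EFinP.
by move=> y; rewrite lee_fin; have /andP[] := f01 y.
Qed.

Lemma trans_op01 x : 0 <= trans_op P X tau t f x <= 1.
Proof.
rewrite -!lee_fin EFin_trans_op; apply/andP; split.
  by apply: integral_ge0 => w _; rewrite lee_fin; have /andP[] := f01 (X t tau x w).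
apply: (@le_trans _ _ (\int[P]__ 1)%E).
  apply: ge0_le_integral => //.
  - by move=> w _; rewrite lee_fin; have /andP[] := f01 (X t tau x w).
  - by apply/measurable_EFinP; exact: measurableT_comp mf (mX x).
  - by move=> w _; rewrite lee_fin; have /andP[] := f01 (X t tau x w).
by rewrite integral_cst// mul1e; exact: probability_le1.
Qed.

End stochastic_family.

(** * Comparison of two stochastic families *)

Section family_comparison.
Context {R : realType} {T : completeMetricType R}.
Context {d : measure_display} {Omega : measurableType d}.
Variable P : probability Omega R.
Hypothesis hT : separable_space T.

(** Separability writes the complementary event as a countable union, over centers [s i] and radii
    [q n], of events on [Y] and [Z] separately. *)
Lemma measurable_mdist_ge (Y Z : Omega -> borel T) (r : R) :
  measurable_fun [set: Omega] Y -> measurable_fun [set: Omega] Z ->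
  measurable [set w | r <= mdist (Y w : T) (Z w : T)].
Proof.
move=> mY mZ; have [s sP] := separable_dense_seq hT.
pose q n : R := n.+1%:R^-1.
have q0 n : 0 < q n by rewrite invr_gt0.
rewrite [X in measurable X](_ : _ = ~` \bigcup_i \bigcup_n
    ((Y @^-1` ball (s i) (q n)) `&` (Z @^-1` ball (s i) (r - q n)))); last first.
  rewrite -[LHS]setCK; congr (~` _); apply/seteqP; split => w /=.
    move=> /negP; rewrite -ltNge => rw.
    (* This gives [2 * q n < r - mdist (Y w) (Z w)], so a center within [q n] of [Y w] is within
       [r - q n] of [Z w]. *)
    pose n := Num.truncn (2 / (r - mdist (Y w : T) (Z w))).
    have qn : q n + q n < r - mdist (Y w : T) (Z w).
      rewrite -mulr2n -mulr_natl ltr_pdivrMr// mulrC -ltr_pdivrMr ?subr_gt0//.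
      exact: truncnS_gt.
    have [i si] := sP (Y w) _ (q0 n).
    exists i => //; exists n => //; split; rewrite /= ballEmdist//=.
    by have := metric_triangle (s i) (Y w) (Z w); lra.
  move=> [i _ [n _ []]]; rewrite /= !ballEmdist /= => iY iZ.
  apply/negP; rewrite -ltNge.
  by have := metric_triangle (Y w) (s i) (Z w); rewrite (metric_sym (Y w) (s i)); lra.
apply: measurableC; apply: bigcup_measurable => i _.
apply: bigcup_measurable => n _; apply: measurableI.
- rewrite -[X in measurable X]setTI; apply: mY => //.
  by apply: open_borel_measurable; exact: open_mball.
- rewrite -[X in measurable X]setTI; apply: mZ => //.
  by apply: open_borel_measurable; exact: open_mball.
Qed.

Variables (X Y : R -> R -> T -> Omega -> T).
Hypotheses (hX : stochastic_family P X) (hY : stochastic_family P Y).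
Variables (tau t : R) (taut : tau <= t).

Lemma trans_op_dist (k delta : R) (f : T -> R) x :
  mlipschitz k f -> (forall y, 0 <= f y <= 1) -> 0 <= k -> 0 < delta ->
  `|trans_op P X tau t f x - trans_op P Y tau t f x| <=
  k * delta +
  fine (P [set w | delta <= mdist (X t tau x w) (Y t tau x w)]).
Proof.
move=> fk f01 k0 delta0.
have mf := continuous_borel_measurable (mlipschitz_continuous fk).
set A := [set w | _].
have mA : measurable A.
  exact: measurable_mdist_ge (stochastic_family_measurable hX taut x)
    (stochastic_family_measurable hY taut x).
rewrite /trans_op unlock -(setCK A).
apply: (@Rintegral_dist_le _ _ _ P (f \o X t tau x) (f \o Y t tau x)).
- exact: measurableC.
- by rewrite mulr_ge0// ltW.
- exact: measurableT_comp mf (stochastic_family_measurable hX taut x).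
- by move=> w; exact: f01.
- exact: measurableT_comp mf (stochastic_family_measurable hY taut x).
- by move=> w; exact: f01.
- move=> w /negP; rewrite -ltNge => /ltW wdelta.
  by apply: le_trans (fk _ _) _; rewrite ler_wpM2l.
Qed.

End family_comparison.

(** Duality of the two operators. Here [nu] is any probability equal to the adjoint on Borel sets,
    so the lemma covers both members of an evolution system and the constructed mixture. *)
Lemma Rintegral_adjoint_op {R : realType} {T : ptopologicalType}
    {d : measure_display} {Omega : measurableType d} (P : probability Omega R)
    (X : R -> R -> T -> Omega -> T) (tau t : R)
    (eta nu : probability (borel T) R) (f : borel T -> R) :
  stochastic_family P X -> tau <= t ->
  (forall L : set (borel T), measurable L -> adjoint_op P X tau t eta L = nu L) ->
  measurable_fun [set: borel T] f -> (forall x, 0 <= f x <= 1) ->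
  (\int[nu]_x f x)%R = (\int[eta]_x trans_op P X tau t f x)%R.
Proof.
move=> hX taut nuE mf f01; rewrite /Rintegral; congr fine.
have [nu' [nu'E nu'I]] := adjoint_op_probability hX taut eta.
transitivity (\int[nu']_x (f x)%:E)%E.
  apply: eq_measure_integral => L mL _.
  by transitivity (adjoint_op P X tau t eta L); [exact/esym/nuE|exact: nu'E].
rewrite (nu'I (EFin \o f)).
- by apply: eq_integral => x _; rewrite (EFin_trans_op hX).
- exact/measurable_EFinP.
- by move=> y; rewrite lee_fin; have /andP[] := f01 y.
Qed.

(** * Passage to the limit in the invariance identity *)

Theorem theorem1p1 (R : realType) (a b : R) (ha : 0 <= a) (hab : a < b)
  (T : completeMetricType R) (hT : separable_space T)
  (d : measure_display) (Omega : measurableType d) (P : probability Omega R)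
  (X : R -> R -> R -> T -> Omega -> T)
  (hX : forall eps : R, eps \in `[a, b] -> stochastic_family P (X eps))
  (hcvg : forall (K : set T), compact K ->
     forall (tau t : R), tau <= t ->
     forall (eps0' : R), eps0' \in `[a, b] ->
     forall (delta : R), 0 < delta ->
       sup [set fine (P [set w | delta <= mdist (X eps t tau x w)
                                                (X eps0' t tau x w)])
           | x in K]
         @[eps --> within [set` `[a, b]] (eps0'^')] --> 0)
  (eps0 : R) (heps0 : eps0 \in `[a, b])
  (eta0 : R -> probability (borel T) R)
  (eps_ : nat -> R) (heps_ : forall n, eps_ n \in `[a, b])
  (eta_ : nat -> R -> probability (borel T) R)
  (heta_ : forall n, evolution_system P (X (eps_ n)) (eta_ n))
  (hfeller : feller P (X eps0))
  (heps_cvg : eps_ n @[n --> \oo] --> eps0)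
  (heta_cvg : forall t : R, weak_cvg (fun n => eta_ n t) (eta0 t)) :
  evolution_system P (X eps0) eta0.
Proof.
move=> tau t taut L mL.
have [nu [nuE _]] := adjoint_op_probability (hX _ heps0) taut (eta0 tau).
rewrite nuE; apply: eq_probability_mlipschitz mL => k' f fk' f01.
(* [mlipschitz] does not fix the sign of its constant; the estimates below use a nonnegative one. *)
have [k k0 fk] : exists2 k, 0 <= k & mlipschitz k f.
  exists `|k'| => // x y; apply: le_trans (fk' x y) _.
  by rewrite ler_wpM2r ?mdist_ge0// ler_norm.
have cf := mlipschitz_continuous fk.
have mf := continuous_borel_measurable cf.
have Cbf : Cb f := Cb01 cf f01.
rewrite (Rintegral_adjoint_op (hX _ heps0) taut (fun L _ => nuE L) mf f01).
suff lim_nu : (\int[eta_ n t]_x f x)%R @[n --> \oo] -->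
    (\int[eta0 tau]_x trans_op P (X eps0) tau t f x)%R.
  exact: cvg_unique lim_nu (heta_cvg t _ Cbf).
have lim0 := heta_cvg tau _ (hfeller tau t taut f Cbf).
apply: (cvg_sub0 _ lim0).
apply/cvgr0Pnorm_le => e e0.
(* The error [e] is split in three: mass outside [K], Lipschitz error [k * delta], and probability
   of a deviation of at least [delta]. *)
have [K cK KP] := weak_cvg_tight hT (heta_cvg tau) (divr_gt0 e0 (ltr0n _ 3)).
(* Dividing by [k + 1] allows [k = 0]. *)
pose delta := e / 3 / (k + 1).
have delta0 : 0 < delta by rewrite !divr_gt0// ltr_wpDl.
have kdelta : k * delta <= e / 3.
  by rewrite /delta mulrCA ler_piMr ?divr_ge0 ?ltW// ltr_pdivrMr ?mul1r; lra.
have mK : measurable (K : set (borel T)).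
  apply: closed_borel_measurable; apply: compact_closed => //.
  exact: metric_hausdorff.
have e30 : 0 < e / 3 by rewrite divr_gt0.
have /cvgr0Pnorm_le/(_ _ e30) near_eps0 :=
  hcvg K cK tau t taut eps0 heps0 delta delta0.
(* The limit in [hcvg] is over a punctured neighborhood, so the bound is known only where [eps_ n]
   differs from [eps0]; where they agree the two operators coincide. *)
have {near_eps0} near_oo : \forall n \near \oo, eps_ n != eps0 ->
    eps_ n \in `[a, b] ->
    `|sup [set fine (P [set w | delta <= mdist (X (eps_ n) t tau x w)
                                              (X eps0 t tau x w)])
          | x in K]| <= e / 3.
  exact: heps_cvg _ near_eps0.
apply: filterS near_oo => n Hn.
rewrite !fctE (Rintegral_adjoint_op (hX _ (heps_ n)) taut (heta_ n tau t taut) mf f01).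
apply: (@le_trans _ _ (e / 3 + e / 3 + fine (eta_ n tau (~` K)))); last first.
  by have := KP n; lra.
apply: Rintegral_dist_le => //.
- by rewrite addr_ge0// ltW.
- exact: (measurable_trans_op (hX _ (heps_ n)) taut mf f01).
- exact: (trans_op01 (hX _ (heps_ n)) taut mf f01).
- exact: (measurable_trans_op (hX _ heps0) taut mf f01).
- exact: (trans_op01 (hX _ heps0) taut mf f01).
- move=> x Kx; have [->|ne] := eqVneq (eps_ n) eps0.
    by rewrite subrr normr0 addr_ge0// ltW.
  apply: le_trans (trans_op_dist hT (hX _ (heps_ n)) (hX _ heps0) taut x fk f01
    k0 delta0) _.
  rewrite lerD//; apply: le_trans (Hn _ _) => //.
  (* A real [sup] dominates its elements only for a bounded set; here 1 bounds all the
     probabilities. *)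
  apply: le_trans (ler_norm _); apply: ub_le_sup; last by exists x.
  exists 1 => _ [y _ <-].
  have mA := measurable_mdist_ge hT delta
    (stochastic_family_measurable (hX _ (heps_ n)) taut y)
    (stochastic_family_measurable (hX _ heps0) taut y).
  by rewrite -lee_fin fineK ?fin_num_measure//; exact: probability_le1.
Qed.
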